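(* Let $\mathbb K=\mathbb F_q$ be a finite field and let $Y\subseteq T_X$ be a subset of the torus of $X$. Then the vanishing ideal $I(Y)$ is a lattice ideal (i.e. $I(Y)=I_L$ for some lattice $L\subseteq\mathbb Z^r$) if and only if $Y$ is a subgroup of $T_X$.
   Context: Setting. $X$ is a complete simplicial toric variety over a field $\mathbb K$ given by a fan $\Sigma\subset\mathbb R^n$ with rays $\rho_1,\dots,\rho_r$ and corresponding primitive lattice generators $\mathbf v_1,\dots,\mathbf v_r\in\mathbb Z^n$. The matrix $\phi:\mathbb Z^n\to\mathbb Z^r$ has rows $\mathbf v_1,\dots,\mathbf v_r$, and there is an exact sequence $0\to\mathbb Z^n\xrightarrow{\phi}\mathbb Z^r\xrightarrow{\beta}\mathcal A\to 0$ with $\mathcal A\cong \mathrm{Cl}(X)$. The Cox ring $S=\mathbb K[x_1,\dots,x_r]$ is graded by $\mathcal A$ via $\deg x_j=\beta_j:=\beta(e_j)$; ''homogeneous'' refers to this grading. Let $\mathbf u_1,\dots,\mathbf u_n\in\mathbb Z^r$ be the columns of $\phi$, write $\mathbf t^{\mathbf u}=t_1^{u_1}\cdots t_r^{u_r}$, let $\pi:(\mathbb K^* )^r\to T_X\cong(\mathbb K^* )^n$, $\pi(\mathbf t)=(\mathbf t^{\mathbf u_1},\dots,\mathbf t^{\mathbf u_n})$, and $G=\ker\pi$. The torus $T_X$ is split and $1\to G\to(\mathbb K^* )^r\xrightarrow{\pi}T_X\to1$ is assumed exact, so $T_X=(\mathbb K^* )^r/G$. The irrelevant ideal is $B=\langle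 \prod_{\rho_i\notin\sigma}x_i : \sigma\in\Sigma\rangle$; the order of the torsion part of $\mathcal A$ is assumed coprime to the characteristic of $\mathbb K$, and points of $X$ are identified with orbits: $X=(\mathbb K^r\setminus V(B))/G$, with $[P]=G\cdot P$ (coordinatewise action). The group law on $T_X$ is coordinatewise multiplication $[P][P']=[PP']$. For $Y\subseteq X$, $I(Y)\subseteq S$ is the ideal generated by the homogeneous polynomials vanishing on $Y$. A lattice is a subgroup $L\subseteq\mathbb Z^r$. Writing $\mathbf m=\mathbf m^+-\mathbf m^-$ with $\mathbf m^{\pm}\in\mathbb N^r$ the positive and negative parts, its lattice ideal is $I_L=\langle \mathbf x^{\mathbf m^+}-\mathbf x^{\mathbf m^-} : \mathbf m\in L\rangle$. *)

(* Defs.v *)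
From HB Require Import structures.
From mathcomp Require Import all_boot all_order all_algebra all_fingroup.
From mathcomp Require Import mpoly.
From mathcomp Require Import boolp classical_sets cardinality reals.

Set Implicit Arguments.
Unset Strict Implicit.
Unset Printing Implicit Defensive.

Import Order.TTheory GRing.Theory Num.Theory.
Local Open Scope ring_scope.

(* In this file [{set T}] is a finite set (finset) and [set T] a subset of an
   arbitrary type (classical_sets).  N = Z^n consists of row vectors, while
   M = Z^n and Z^r consist of column vectors, so that phi : Z^n -> Z^r is left
   multiplication by the r x n matrix whose i-th row is v_i. *)

(** * Fans in R^n *)

Section Fans.
Variables (R : realType) (n : nat).
Implicit Types (s t rho : set 'rV[R]_n) (Sigma : set (set 'rV[R]_n)).

Definition cone_hull k (w : 'M[R]_(k, n)) : set 'rV[R]_n :=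
  [set x | exists c : 'rV[R]_k, (forall j, 0 <= c 0 j) /\ x = c *m w]%classic.

Definition rational_polyhedral s : Prop :=
  exists k (w : 'M[int]_(k, n)), s = cone_hull (map_mx intr w).

Definition strongly_convex s : Prop := forall x, s x -> s (- x) -> x = 0.

Definition face_of t s : Prop :=
  exists u : 'cV[R]_n,
    (forall x, s x -> 0 <= (x *m u) 0 0) /\
    t = [set x | s x /\ (x *m u) 0 0 = 0]%classic.

Definition simplicial_cone s : Prop :=
  exists k (w : 'M[R]_(k, n)), row_free w /\ s = cone_hull w.

Definition one_dimensional_cone s : Prop :=
  exists w : 'rV[R]_n, w != 0 /\ s = cone_hull w.

Definition is_fan Sigma : Prop :=
  [/\ finite_set Sigma,
      forall s, Sigma s -> rational_polyhedral s /\ strongly_convex s,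
      forall s t, Sigma s -> face_of t s -> Sigma t
    & forall s t, Sigma s -> Sigma t ->
        face_of (s `&` t)%classic s /\ face_of (s `&` t)%classic t].

Definition complete_fan Sigma : Prop :=
  (\bigcup_(s in Sigma) s = [set: 'rV[R]_n])%classic.

Definition simplicial_fan Sigma : Prop := forall s, Sigma s -> simplicial_cone s.

Definition primitive_vector (v : 'rV[int]_n) : Prop :=
  \big[gcdn/0%N]_(j < n) absz (v 0 j) = 1%N.

Variable r : nat.

Definition ray (phi : 'M[int]_(r, n)) (i : 'I_r) : set 'rV[R]_n :=
  cone_hull (map_mx intr (row i phi)).

Definition ray_generators Sigma (phi : 'M[int]_(r, n)) : Prop :=
  [/\ forall i, primitive_vector (row i phi),
      injective (ray phi)
    & forall rho, (exists i, rho = ray phi i) <->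
                  (Sigma rho /\ one_dimensional_cone rho)].

End Fans.

Arguments ray R {n r} phi i _ : assert.

(** * The class group and the grading *)

Section ClassGroup.
Variables (n r : nat) (phi : 'M[int]_(r, n)).
Variables (A : zmodType) (beta : {additive 'cV[int]_r -> A}).

Definition class_group_exact : Prop :=
  [/\ injective (fun m : 'cV[int]_n => phi *m m),
      forall a : 'cV[int]_r, beta a = 0 <-> exists m : 'cV[int]_n, a = phi *m m
    & forall b : A, exists a, beta a = b].

Definition torsion_order (N : nat) : Prop :=
  exists ts : seq A,
    [/\ uniq ts, size ts = N
      & forall a, a \in ts <-> exists2 k, (0 < k)%N & a *+ k = 0].

Definition var_degree (j : 'I_r) : A := beta (delta_mx j 0).

Definition mono_degree (m : 'X_{1..r}) : A := \sum_(j < r) var_degree j *+ m j.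

Definition homogeneous (K : nzRingType) (f : {mpoly K[r]}) : Prop :=
  exists alpha : A, forall m, m \in msupp f -> mono_degree m = alpha.

End ClassGroup.

(** * Ideals of the Cox ring *)

Section Ideals.
Variables (r : nat) (K : comNzRingType).

Definition ideal_gen (F : set {mpoly K[r]}) : set {mpoly K[r]} :=
  [set f | exists k (c g : 'I_k -> {mpoly K[r]}),
     (forall i, F (g i)) /\ f = \sum_(i < k) c i * g i]%classic.

Definition pos_part (m : 'cV[int]_r) : 'X_{1..r} :=
  [multinom absz (Num.max (m i 0%R) 0%R) | i < r].

Definition neg_part (m : 'cV[int]_r) : 'X_{1..r} := pos_part (- m).

Definition lattice_ideal (L : {pred 'cV[int]_r}) : set {mpoly K[r]} :=
  ideal_gen [set f | exists2 m : 'cV[int]_r,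
    m \in L & f = 'X_[pos_part m] - 'X_[neg_part m]]%classic.

(* [zmod_closed L] says that L is a subgroup of Z^r. *)
Definition is_lattice_ideal (I : set {mpoly K[r]}) : Prop :=
  exists L : {pred 'cV[int]_r}, zmod_closed L /\ I = lattice_ideal L.

Definition irrelevant_ideal (R : realType) n
    (Sigma : set (set 'rV[R]_n)) (phi : 'M[int]_(r, n)) : set {mpoly K[r]} :=
  ideal_gen [set f | exists2 s : set 'rV[R]_n, Sigma s &
    f = \prod_(i < r | `[< ~ (ray R phi i `<=` s)%classic >]) 'X_i]%classic.

End Ideals.

Arguments irrelevant_ideal {r} K {R n} Sigma phi _ : assert.

(** * Tori *)

Notation affine_space K r := {ffun 'I_r -> K}.
Notation split_torus K r := {dffun forall _ : 'I_r, {unit K}}.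

Section Torus.
Variable K : finFieldType.

Definition unit_expz (x : {unit K}) (z : int) : {unit K} :=
  match z with Posz k => (x ^+ k)%g | Negz k => (x ^- k.+1)%g end.

Lemma unit_expzM z : {morph unit_expz^~ z : x y / (x * y)%g}.
Proof.
have cU (x y : {unit K}) : commute x y by apply: val_inj; rewrite /= mulrC.
move=> x y; case: z => k /=; rewrite (expgMn _ (cU x y)) // invMg.
exact: cU.
Qed.

Lemma unit_expzE (x : {unit K}) z : val (unit_expz x z) = val x ^ z.
Proof. by case: z => k; rewrite /= ?FinRing.val_unitV !FinRing.val_unitX. Qed.

Variables (n r : nat) (phi : 'M[int]_(r, n)).

Definition torus_map_fun (t : split_torus K r) : split_torus K n :=
  [ffun j => \prod_(i < r) unit_expz (t i) (phi i j)]%g.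

Lemma torus_map_morph :
  {in [set: split_torus K r] &, {morph torus_map_fun : s t / (s * t)%g}}.
Proof.
have cU (x y : {unit K}) : (x * y = y * x)%g by apply: val_inj; rewrite /= mulrC.
move=> s t _ _; apply/ffunP => j; rewrite dffunM !ffunE.
under eq_bigr do rewrite dffunM unit_expzM.
elim: (index_enum _) => [|i l IH]; first by rewrite !big_nil mulg1.
by rewrite !big_cons IH -!mulgA; congr (_ * _)%g; rewrite !mulgA [(_ * unit_expz (t i) _)%g]cU.
Qed.

(* The map pi, so that G is ['ker torus_map]. *)
Canonical torus_map := Morphism torus_map_morph.

(* T_X = (K^* )^r / G, a finite group whose elements are the cosets of G. *)
Definition toric_torus := coset_of ('ker torus_map)%g.

Definition torus_point (t : split_torus K r) : affine_space K r :=
  [ffun i => val (t i)].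

Definition torus_scale (g : split_torus K r) (P : affine_space K r) :
  affine_space K r := [ffun i => val (g i) * P i].

Definition cox_class (P : affine_space K r) : {set affine_space K r} :=
  [set torus_scale g P | g in ('ker torus_map)%g].

Variables (R : realType) (Sigma : set (set 'rV[R]_n)).

Definition irrelevant_locus : {set affine_space K r} :=
  [set P : affine_space K r |
    `[< forall f, irrelevant_ideal K Sigma phi f -> f.@[P] = 0 >]].

Definition toric_variety : {set {set affine_space K r}} :=
  [set cox_class P | P in ~: irrelevant_locus].

Definition torus_in_variety : {set {set affine_space K r}} :=
  [set cox_class P | P in ~: irrelevant_locus & [forall i, P i != 0]].

Lemma torus_in_variety_sub : torus_in_variety \subset toric_variety.
Proof.
apply/fintype.subsetP => y /imsetP[P]; rewrite inE => /andP[PX _] ->.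
by apply/imsetP; exists P.
Qed.

(* A coset t G inside (K^* )^r, viewed inside K^r, is the orbit [t]. *)
Definition torus_incl (C : toric_torus) : {set affine_space K r} :=
  torus_point @: (C : {set split_torus K r}).

Lemma torus_incl_coset t : torus_incl (coset _ t) = cox_class (torus_point t).
Proof.
have Nt : t \in ('N('ker torus_map))%g by apply: (fintype.subsetP (ker_norm torus_map)); rewrite inE.
have pM g : torus_point (g * t)%g = torus_scale g (torus_point t).
  by apply/ffunP => i; rewrite !ffunE.
rewrite /torus_incl val_coset //; apply/setP => P; apply/imsetP/imsetP.
  by move=> [x /rcosetP[g gK ->] ->]; exists g; rewrite ?pM.
by move=> [g gK ->]; exists (g * t)%g; rewrite ?pM // mem_rcoset mulgK.
Qed.

Lemma torus_inclT : complete_fan Sigma ->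
  torus_incl @: [set: toric_torus] = torus_in_variety.
Proof.
move=> complete_Sigma; apply/setP => y; apply/imsetP/imsetP.
  move=> [C _ ->]; have [t _ ->] := cosetP C.
  exists (torus_point t); last exact: torus_incl_coset.
  rewrite !inE; apply/andP; split; last first.
    by apply/forallP => i; rewrite ffunE -unitfE (valP (t i)).
  apply/negP => /asboolP zero_t.
  have [s Ss _] : (\bigcup_(s in Sigma) s)%classic 0 by rewrite complete_Sigma.
  pose f : {mpoly K[r]} :=
    \prod_(i < r | `[< ~ (ray R phi i `<=` s)%classic >]) 'X_i.
  have /zero_t : irrelevant_ideal K Sigma phi f.
    exists 1%N, (fun=> 1), (fun=> f); split; last by rewrite big_ord1 mul1r.
    by move=> _; exists s.
  rewrite rmorph_prod; apply/eqP/prodf_neq0 => i _.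
  by rewrite /= mevalXU ffunE -unitfE (valP (t i)).
move=> [P]; rewrite !inE => /andP[_ /forallP P0] ->.
have uP i : P i \is a GRing.unit by rewrite unitfE.
pose t : split_torus K r := [ffun i => FinRing.unit K (uP i)].
exists (coset _ t) => //; rewrite torus_incl_coset; congr cox_class.
by apply/ffunP => i; rewrite !ffunE.
Qed.

Definition is_torus_subgroup (Y : {set {set affine_space K r}}) : Prop :=
  exists H : {group toric_torus}, Y = torus_incl @: H.

End Torus.

Arguments torus_map K {n r} phi.
Arguments toric_variety K {n r} phi {R} Sigma.
Arguments torus_in_variety K {n r} phi {R} Sigma.

(** * Vanishing ideals of sets of points of X *)

Section VanishingIdeal.
Variables (K : finFieldType) (r : nat).
Variables (A : zmodType) (beta : {additive 'cV[int]_r -> A}).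

Definition vanishes_on (Y : {set {set affine_space K r}}) (f : {mpoly K[r]}) :=
  forall y, y \in Y -> forall P : affine_space K r, P \in y -> f.@[P] = 0.

Definition vanishing_ideal (Y : {set {set affine_space K r}}) :
  set {mpoly K[r]} :=
  ideal_gen [set f | homogeneous beta f /\ vanishes_on Y f]%classic.

End VanishingIdeal.

(* Main.v *)
Require Import Defs.
From mathcomp Require Import all_boot all_order all_algebra all_fingroup.
From mathcomp Require Import cyclic finfield.
From mathcomp Require Import zify ring.
From mathcomp Require Import mpoly.
From mathcomp Require Import boolp classical_sets cardinality reals.

(** Write H for the subset of the big torus (K^* )^r lying over Y; it is a union
    of cosets of G, and a homogeneous polynomial belongs to I(Y) exactly when it
    vanishes on H.  Each exponent m in Z^r is a character t |-> t^m of the big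
    torus, and x^(m+) - x^(m-) vanishes at t exactly when t^m = 1.  It is
    homogeneous as soon as m lies in ker beta.

    If Y is a subgroup, so is H, and I(Y) = I_L for the lattice L of all m in
    ker beta whose character is trivial on H.  Indeed, let f be homogeneous and
    vanish on H.  Restricted to H, its monomials are characters, and distinct
    characters are linearly independent (Dedekind); so the coefficients of f
    sum to zero over each set of monomials that induce the same character.
    Hence f is a combination of differences x^a - x^b with a - b in L
    ([homogeneous_vanishing_lattice]).

    Conversely, let I(Y) = I_L.  The points t with t^m = 1 for all m in L form a
    subgroup V of the big torus, and H is contained in V because the binomials
    of I_L vanish on H.  If t is outside H, then pi(t) is outside the finite
    set pi(H), and there is a homogeneous polynomial that is nonzero at t and
    zero at every torus point with another image under pi
    ([separating_polynomial]).  This polynomial is in I(Y) = I_L, so t is not in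
    V.  Thus H = V is a subgroup; in particular Y is nonempty, since V contains 1.

    The separating polynomial is where the finiteness of K enters: if q = #|K|
    and X, Y are nonzero in K, then X^(q-1) = Y^(q-1) = 1, so the sum of the
    X^(q-2-i) Y^i over i < q-1 is zero unless X = Y.  This gives the
    indicator function of t^u = c already homogenized, whereas reducing
    exponents modulo q-1 would change degrees. *)

Local Open Scope ring_scope.
Import GRing.Theory.

(** * Generated ideals *)

Section IdealGen.
Context {r : nat} {K : comNzRingType}.
Implicit Types (F G : set {mpoly K[r]}) (f g : {mpoly K[r]}).

Lemma mem_ideal_gen F f : F f -> ideal_gen F f.
Proof.
move=> Ff; exists 1%N, (fun=> 1), (fun=> f).
by split=> //; rewrite big_ord1 mul1r.
Qed.

Lemma ideal_gen0 F : ideal_gen F 0.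
Proof.
exists 0%N, (fun=> 0), (fun=> 0); split; first by case.
by rewrite big_ord0.
Qed.

Lemma ideal_genD F f g : ideal_gen F f -> ideal_gen F g -> ideal_gen F (f + g).
Proof.
move=> [k1 [c1 [g1 [F1 ->]]]] [k2 [c2 [g2 [F2 ->]]]].
exists (k1 + k2)%N.
exists (fun i => match fintype.split i with inl j => c1 j | inr j => c2 j end).
exists (fun i => match fintype.split i with inl j => g1 j | inr j => g2 j end).
split; first by move=> i; case: (fintype.split i).
rewrite big_split_ord; congr (_ + _); apply: eq_bigr => i _.
  by rewrite (unsplitK (inl i)).
by rewrite (unsplitK (inr i)).
Qed.

Lemma ideal_genM F f g : ideal_gen F g -> ideal_gen F (f * g).
Proof.
move=> [k [c [h [Fh ->]]]]; exists k, (fun i => f * c i), h; split=> //.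
by rewrite big_distrr /=; apply: eq_bigr => i _; rewrite mulrA.
Qed.

Lemma ideal_gen_sum F (I : Type) (s : seq I) (P : pred I)
    (h : I -> {mpoly K[r]}) :
  (forall i, P i -> ideal_gen F (h i)) -> ideal_gen F (\sum_(i <- s | P i) h i).
Proof.
move=> Fh; elim/big_rec: _ => [|i x Pi Fx]; first exact: ideal_gen0.
by apply: ideal_genD => //; apply: Fh.
Qed.

Lemma ideal_gen_min F G :
  (forall f, F f -> ideal_gen G f) -> (ideal_gen F `<=` ideal_gen G)%classic.
Proof.
move=> FG f [k [c [g [Fg ->]]]]; apply: ideal_gen_sum => i _.
exact/ideal_genM/FG.
Qed.

Lemma ideal_gen_root F f (P : 'I_r -> K) :
  (forall g, F g -> g.@[P] = 0) -> ideal_gen F f -> f.@[P] = 0.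
Proof.
move=> F0 [k [c [g [Fg ->]]]]; rewrite raddf_sum big1 // => i _.
by rewrite /= mevalM (F0 _ (Fg i)) mulr0.
Qed.

End IdealGen.

(** * Exponent vectors and degrees *)

Section Exponents.
Context {r : nat}.
Implicit Types (a b : 'X_{1..r}) (m : 'cV[int]_r).

Definition exponent_vector a : 'cV[int]_r := \col_i (a i)%:Z.

Lemma exponent_vector_pos_part m :
  exponent_vector (pos_part m) = m + exponent_vector (neg_part m).
Proof.
apply/colP => i; rewrite !mxE /pos_part /neg_part /= !mnmE mxE.
(* The entry is generalized so that [lia] sees one variable. *)
by move: (m i 0) => z; lia.
Qed.

Lemma mono_degreeE (A : zmodType) (beta : {additive 'cV[int]_r -> A}) a :
  mono_degree beta a = beta (exponent_vector a).
Proof.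
have -> : exponent_vector a = \sum_(j < r) delta_mx j 0 *+ a j.
  apply/colP => i; rewrite !mxE summxE (bigD1 i) //= big1 => [|j /negPf ji].
    by rewrite addr0 mulmxnE mxE !eqxx /=; lia.
  by rewrite mulmxnE mxE [i == j]eq_sym ji mul0rn.
by rewrite raddf_sum; apply: eq_bigr => j _; rewrite raddfMn.
Qed.

Lemma mono_degree_pos_part (A : zmodType) (beta : {additive 'cV[int]_r -> A}) m :
  beta m = 0 -> mono_degree beta (pos_part m) = mono_degree beta (neg_part m).
Proof.
by move=> bm; rewrite !mono_degreeE exponent_vector_pos_part raddfD bm add0r.
Qed.

(** Cancelling the common factor of two monomials: this is why x^a - x^b lies in
    a lattice ideal as soon as a - b lies in the lattice. *)
Lemma mpolyXB (K : nzRingType) a b :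
  let m := exponent_vector a - exponent_vector b in
  'X_[a] - 'X_[b] =
  'X_[[multinom minn (a i) (b i) | i < r]] * ('X_[pos_part m] - 'X_[neg_part m])
  :> {mpoly K[r]}.
Proof.
move=> m; rewrite mulrBr -!mpolyXD; congr ('X_[_] - 'X_[_]);
  by apply/mnmP => i; rewrite mnmDE /pos_part /neg_part !mnmE !mxE; lia.
Qed.

End Exponents.

Section Homogeneous.
Context {r : nat} {A : zmodType} {beta : {additive 'cV[int]_r -> A}}.
Context {K : nzRingType}.
Implicit Types f g : {mpoly K[r]}.

(** Sums preserve homogeneity only in a common degree, so that degree has to be
    named. *)
Definition homogeneous_of (alpha : A) f : Prop :=
  forall m, m \in msupp f -> mono_degree beta m = alpha.

Lemma homogeneous_ofX a : homogeneous_of (mono_degree beta a) 'X_[a].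
Proof. by move=> m; rewrite msuppX inE => /eqP->. Qed.

Lemma homogeneous_ofZ alpha c f :
  homogeneous_of alpha f -> homogeneous_of alpha (c *: f).
Proof. by move=> hf m /msuppZ_le; apply: hf. Qed.

Lemma homogeneous_ofD alpha f g : homogeneous_of alpha f ->
  homogeneous_of alpha g -> homogeneous_of alpha (f + g).
Proof.
by move=> hf hg m /msuppD_le; rewrite mem_cat => /orP[/hf|/hg].
Qed.

Lemma homogeneous_lattice_binomial (m : 'cV[int]_r) :
  beta m = 0 -> homogeneous beta ('X_[pos_part m] - 'X_[neg_part m] : {mpoly K[r]}).
Proof.
move=> bm; exists (mono_degree beta (neg_part m)).
rewrite -scaleN1r; apply: homogeneous_ofD; last first.
  exact/homogeneous_ofZ/homogeneous_ofX.
by rewrite -mono_degree_pos_part //; apply: homogeneous_ofX.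
Qed.

Lemma homogeneous_ofM alpha alpha' f g : homogeneous_of alpha f ->
  homogeneous_of alpha' g -> homogeneous_of (alpha + alpha') (f * g).
Proof.
move=> hf hg m /msuppM_le/allpairsP[[a b] /= [/hf <- /hg <- ->]].
by rewrite /mono_degree -big_split; apply: eq_bigr => j _; rewrite mnmDE mulrnDr.
Qed.

Lemma homogeneous_of1 : homogeneous_of 0 1.
Proof.
by move=> m; rewrite msupp1 inE => /eqP->; rewrite /mono_degree big1 // => j _;
  rewrite mnm0E.
Qed.

Lemma homogeneous_of_exp alpha f k :
  homogeneous_of alpha f -> homogeneous_of (alpha *+ k) (f ^+ k).
Proof.
move=> hf; elim: k => [|k IH]; first exact: homogeneous_of1.
by rewrite exprS mulrS; apply: homogeneous_ofM.
Qed.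

Lemma homogeneous_of_sum alpha (I : Type) (s : seq I) (h : I -> {mpoly K[r]}) :
  (forall i, homogeneous_of alpha (h i)) ->
  homogeneous_of alpha (\sum_(i <- s) h i).
Proof.
move=> hh; elim/big_rec: _ => [m|i x _]; first by rewrite msupp0.
exact: homogeneous_ofD.
Qed.

End Homogeneous.

(** * Independence of characters *)

(** Dedekind's argument, in a form where [chi] may repeat a character: in a
    vanishing combination of [chi j] and of characters other than [chi j], the
    coefficient of [chi j] is zero.  If [chi i0] is another one, choose [x] with
    [chi i0 x != chi j x]; subtracting [chi i0 x] times the relation at [y] from
    the relation at [x * y] removes [chi i0] and multiplies [a] by the nonzero
    [chi j x - chi i0 x]. *)
Lemma dedekind_character_coef (K : idomainType) (gT : finGroupType)
    (G : {group gT}) (I : Type) (chi : I -> gT -> K) (s : seq I) (j : I)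
    (a : K) (c : I -> K) :
  (forall i, chi i 1%g = 1) ->
  (forall i, {in G &, {morph chi i : x y / (x * y)%g >-> x * y}}) ->
  (forall x, x \in G -> a * chi j x +
     \sum_(i <- s | ~~ [forall x in G, chi i x == chi j x]) c i * chi i x = 0) ->
  a = 0.
Proof.
move=> chi1 chiM.
elim: s a c => [|i0 s IH] a c eqn.
  by have := eqn _ (group1 G); rewrite big_nil addr0 chi1 mulr1.
have [same|/forall_inPn[x Gx neq_x]] :=
    boolP [forall x in G, chi i0 x == chi j x].
  by apply: (IH a c) => y Gy; have := eqn y Gy; rewrite big_cons same.
suff /eqP : a * (chi j x - chi i0 x) = 0.
  by rewrite mulf_eq0 subr_eq0 [_ == chi i0 x]eq_sym (negPf neq_x) orbF => /eqP.
apply: (IH _ (fun i => c i * (chi i x - chi i0 x))) => y Gy.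
have diff : ~~ [forall x in G, chi i0 x == chi j x].
  by apply/forall_inPn; exists x.
have := eqn _ (groupM Gx Gy); have := eqn _ Gy.
rewrite !big_cons diff !chiM //.
set S1 := \sum_(i <- s | _) _; set S2 := \sum_(i <- s | _) _ => e1 e2.
have -> : \sum_(i <- s | ~~ [forall x in G, chi i x == chi j x])
            c i * (chi i x - chi i0 x) * chi i y = S2 - chi i0 x * S1.
  rewrite /S1 /S2 big_distrr -sumrB; apply: eq_bigr => i _.
  by rewrite /= chiM // mulrBr mulrBl !mulrA; congr (_ - _); rewrite [_ * c i]mulrC.
by rewrite -[RHS](subr0 0) -{1}e2 -(mulr0 (chi i0 x)) -e1; ring.
Qed.

(** * Characters of the big torus *)

Section TorusCharacters.
Context {K : finFieldType} {r : nat}.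
Implicit Types (s t : split_torus K r) (m : 'cV[int]_r).

Definition torus_char t m : K := \prod_(i < r) val (t i) ^ m i 0.

Lemma split_torus_neq0 t i : val (t i) != 0.
Proof. by rewrite -unitfE (valP (t i)). Qed.

Lemma torus_char_neq0 t m : torus_char t m != 0.
Proof. by apply/prodf_neq0 => i _; rewrite expfz_neq0 ?split_torus_neq0. Qed.

Lemma torus_char0 t : torus_char t 0 = 1.
Proof. by rewrite /torus_char big1 // => i _; rewrite mxE expr0z. Qed.

Lemma torus_charD t m m' :
  torus_char t (m + m') = torus_char t m * torus_char t m'.
Proof.
rewrite /torus_char -big_split; apply: eq_bigr => i _ /=.
by rewrite mxE expfzDr ?split_torus_neq0.
Qed.

Lemma torus_charB t m m' :
  torus_char t (m - m') = torus_char t m / torus_char t m'.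
Proof.
by rewrite -{2}(subrK m' m) (torus_charD t (m - m')) mulfK ?torus_char_neq0.
Qed.

Lemma torus_char1 m : torus_char 1%g m = 1.
Proof. by rewrite /torus_char big1 // => i _; rewrite ffunE exp1rz. Qed.

Lemma torus_charM s t m :
  torus_char (s * t)%g m = torus_char s m * torus_char t m.
Proof.
rewrite /torus_char -big_split; apply: eq_bigr => i _ /=.
by rewrite ffunE -expfzMl.
Qed.

Lemma meval_torus_char t a :
  'X_[a].@[torus_point t] = torus_char t (exponent_vector a).
Proof. by rewrite mevalX; apply: eq_bigr => i _; rewrite mxE ffunE. Qed.

Lemma meval_lattice_binomial t m :
  ('X_[pos_part m] - 'X_[neg_part m]).@[torus_point t] = 0 <->
  torus_char t m = 1.
Proof.
rewrite mevalB !meval_torus_char exponent_vector_pos_part torus_charD.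
rewrite -{2}[torus_char t (exponent_vector _)]mul1r -mulrBl.
split=> [/eqP|->]; last by rewrite subrr mul0r.
by rewrite mulf_eq0 (negPf (torus_char_neq0 _ _)) orbF subr_eq0 => /eqP.
Qed.

Lemma val_torus_map n (phi : 'M[int]_(r, n)) t j :
  val (torus_map K phi t j) = torus_char t (col j phi).
Proof.
rewrite /torus_map /= ffunE /torus_char (big_morph val (fun _ _ => erefl) erefl).
by apply: eq_bigr => i _; rewrite unit_expzE mxE.
Qed.

End TorusCharacters.

Lemma finField_expf_card1 (K : finFieldType) (x : K) : x != 0 -> x ^+ #|K|.-1 = 1.
Proof.
move=> x0; apply: (mulfI x0).
by rewrite -exprS prednK ?expf_card ?mulr1 //; apply/card_gt0P; exists 0.
Qed.

Lemma finField_natr_card_pred (K : finFieldType) : (#|K|.-1)%:R != 0 :> K.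
Proof.
have cardK : #|K|%:R = 0 :> K.
  by rewrite -cardsT -FinRing.zmodXgE (expg_cardG (G := [set: K]%G)) ?inE.
have K0 : (0 < #|K|)%N by apply/card_gt0P; exists 0.
apply/eqP => pred0; move: cardK; rewrite -(prednK K0) -natr1 pred0 add0r.
by apply/eqP/oner_neq0.
Qed.

(** * The torus as a quotient *)

Section Orbits.
Context {K : finFieldType} {n r : nat} {phi : 'M[int]_(r, n)}.
Implicit Types s t : split_torus K r.

Let G := ('ker (torus_map K phi))%g.

Lemma torus_norm_ker t : t \in 'N(G)%g.
Proof. by apply: (fintype.subsetP (ker_norm (torus_map K phi))); rewrite inE. Qed.

Lemma eq_coset_torus_map s t :
  torus_map K phi s = torus_map K phi t -> coset G s = coset G t.
Proof.
move=> st; apply/rcoset_kercosetP; rewrite ?torus_norm_ker //.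
have [||z Gz ->] := ker_rcoset _ _ st; rewrite ?inE //.
by rewrite mem_rcoset mulgK.
Qed.

Lemma mem_torus_incl P s :
  P \in torus_incl (coset G s) <->
  exists2 t, coset G t = coset G s & P = torus_point t.
Proof.
split=> [/imsetP[t st ->]|[t st ->]].
  exists t => //; apply/rcoset_kercosetP; rewrite ?torus_norm_ker //.
  by rewrite -val_coset ?torus_norm_ker.
apply/imsetP; exists t => //; rewrite -st val_coset ?torus_norm_ker //.
exact: rcoset_refl.
Qed.

Lemma toric_torusP (C : toric_torus K phi) : exists t, C = coset G t.
Proof. by have [t _ ->] := cosetP C; exists t. Qed.

Lemma torus_incl_inj : injective (@torus_incl K n r phi).
Proof.
move=> C D; have [s ->] := toric_torusP C; have [t ->] := toric_torusP D => st.
have /(mem_torus_incl _ t)[t' <- e] : torus_point s \in torus_incl (coset G t).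
  by rewrite -st; apply/mem_torus_incl; exists s.
congr coset; apply/ffunP => i; apply: val_inj.
by move/ffunP/(_ i) : e; rewrite !ffunE.
Qed.

(** Each point of an orbit in [Y] is a torus point whose own orbit is that same
    one, so every point can serve as the chosen representative. *)
Lemma vanishes_onE (Y : {set {set affine_space K r}}) (f : {mpoly K[r]}) :
  Y \subset torus_incl (phi := phi) @: [set: toric_torus K phi] ->
  vanishes_on Y f <->
  forall t, torus_incl (coset G t) \in Y -> f.@[torus_point t] = 0.
Proof.
move=> /fintype.subsetP YT; split=> [fY t tY|f0 y yY P].
  by apply: (fY _ tY); apply/mem_torus_incl; exists t.
have /imsetP[C _ ey] := YT y yY; have [s eC] := toric_torusP C.
rewrite ey eC.
by move/mem_torus_incl=> [t ts ->]; apply: f0; rewrite ts -eC -ey.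
Qed.

End Orbits.

(** * Separating points of the torus *)

Section Separation.
Context {K : finFieldType} {n r : nat} {phi : 'M[int]_(r, n)}.
Context {A : zmodType} {beta : {additive 'cV[int]_r -> A}}.

(** With [X] and [Y] evaluating to (s^u / t^u) s^(u-) and s^(u-) at s, the sum of
    the X^(q-2-i) Y^i equals (X^(q-1) - Y^(q-1)) / (X - Y) = 0 when s^u differs
    from t^u; at s = t it is (q-1) Y^(q-2), which is nonzero since q-1 = -1 in
    K.  [X] and [Y] have the same degree because u is in ker beta. *)
Lemma separating_factor (u : 'cV[int]_r) (t : split_torus K r) :
  beta u = 0 ->
  exists alpha (f : {mpoly K[r]}),
    [/\ homogeneous_of (beta := beta) alpha f, f.@[torus_point t] != 0
      & forall s, f.@[torus_point s] != 0 -> torus_char s u = torus_char t u].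
Proof.
move=> u0; set c := torus_char t u.
set X : {mpoly K[r]} := c^-1 *: 'X_[pos_part u].
set Y : {mpoly K[r]} := 'X_[neg_part u].
set alpha := mono_degree beta (neg_part u).
have hX : homogeneous_of (beta := beta) alpha X.
  rewrite /alpha -mono_degree_pos_part //.
  exact/homogeneous_ofZ/homogeneous_ofX.
exists (alpha *+ #|K|.-1.-1).
exists (\sum_(i < #|K|.-1) X ^+ (#|K|.-1.-1 - i) * Y ^+ i).
have evX s : X.@[torus_point s] = c^-1 * torus_char s u * Y.@[torus_point s].
  by rewrite mevalZ !meval_torus_char exponent_vector_pos_part torus_charD mulrA.
have Y0 s : Y.@[torus_point s] != 0 by rewrite meval_torus_char torus_char_neq0.
have ev s : (\sum_(i < #|K|.-1) X ^+ (#|K|.-1.-1 - i) * Y ^+ i).@[torus_point s]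
   = \sum_(i < #|K|.-1) X.@[torus_point s] ^+ (#|K|.-1.-1 - i) *
        Y.@[torus_point s] ^+ i.
  by rewrite raddf_sum; apply: eq_bigr => i _; rewrite /= mevalM !rmorphXn.
split.
- apply: homogeneous_of_sum => i.
  have i_le : (i <= #|K|.-1.-1)%N by case: i => i /=; lia.
  rewrite -(subnK i_le) mulrnDr (subnK i_le).
  apply: homogeneous_ofM; apply: homogeneous_of_exp => //.
  exact: homogeneous_ofX.
- rewrite ev evX mulVf ?torus_char_neq0 // mul1r.
  under eq_bigr => i _.
    rewrite -exprD subnK; last by case: i => i /=; lia.
  over.
  by rewrite sumr_const card_ord -mulr_natr mulf_neq0 ?expf_neq0
             ?finField_natr_card_pred.
move=> s; rewrite ev => neq0.
have X0 : X.@[torus_point s] != 0.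
  by rewrite evX !mulf_neq0 ?invr_neq0 ?torus_char_neq0.
have /eqP := subrXX (X.@[torus_point s]) (Y.@[torus_point s]) #|K|.-1.
rewrite !finField_expf_card1 // subrr eq_sym mulf_eq0 (negPf neq0) orbF.
rewrite subr_eq0 evX -{2}[Y.@[_]]mul1r => /eqP/(mulIf (Y0 s)) e.
by rewrite -[LHS](mulVKf (torus_char_neq0 t u)) e mulr1.
Qed.

(** The coordinates of pi are the characters of the columns of phi, and by
    exactness these columns lie in ker beta: multiply one factor per column. *)
Lemma separating_polynomial (t : split_torus K r) :
  class_group_exact phi beta ->
  exists f : {mpoly K[r]},
    [/\ homogeneous beta f, f.@[torus_point t] != 0
      & forall s, f.@[torus_point s] != 0 ->
          torus_map K phi s = torus_map K phi t].
Proof.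
move=> [_ exact_phi _].
have col0 j : beta (col j phi) = 0.
  by apply/exact_phi; exists (delta_mx j 0); rewrite colE.
have /fin_all_exists[alpha /fin_all_exists[f hf]] :=
  fun j => @separating_factor (col j phi) t (col0 j).
exists (\prod_j f j); split.
- exists (\sum_j alpha j).
  elim/big_rec2: _ => [|j a g _ hg]; first exact: homogeneous_of1.
  by apply: homogeneous_ofM => //; have [] := hf j.
- by rewrite rmorph_prod; apply/prodf_neq0 => j _; have [] := hf j.
move=> s; rewrite rmorph_prod => /prodf_neq0 neq0.
apply/ffunP => j; apply: val_inj; rewrite !val_torus_map.
by have [_ _] := hf j; apply; apply: neq0.
Qed.

End Separation.

(** * The lattice of a subgroup *)

Section LatticeOfSubgroup.
Context {K : finFieldType} {r : nat}.
Context {A : zmodType} (beta : {additive 'cV[int]_r -> A}).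
Context (H : {group (split_torus K r)}).

Definition trivial_exponents : {pred 'cV[int]_r} :=
  [pred m | (beta m == 0) && [forall t in H, torus_char t m == 1]].

Lemma trivial_exponentsP m :
  reflect (beta m = 0 /\ forall t, t \in H -> torus_char t m = 1)
          (m \in trivial_exponents).
Proof.
rewrite inE; apply: (iffP andP) => [[/eqP b0 /forall_inP h]|[-> h]].
  by split=> // t /h/eqP.
by rewrite eqxx; split=> //; apply/forall_inP => t /h ->.
Qed.

Lemma zmod_closed_trivial_exponents : zmod_closed trivial_exponents.
Proof.
split=> [|m m' /trivial_exponentsP[bm hm] /trivial_exponentsP[bm' hm']].
  by apply/trivial_exponentsP; split=> [|t _]; rewrite ?raddf0 ?torus_char0.
apply/trivial_exponentsP; split=> [|t Ht]; first by rewrite raddfB bm bm' subr0.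
by rewrite torus_charB hm // hm' // divr1.
Qed.

(** Group the monomials of [f] by the character that they induce on [H]. In each
    group the coefficients sum to zero, so subtracting one fixed monomial [b] of
    the group from all the others does not change the sum; and a - b is
    in ker beta because [f] is homogeneous. *)
Lemma homogeneous_vanishing_lattice (f : {mpoly K[r]}) :
  homogeneous beta f -> (forall t, t \in H -> f.@[torus_point t] = 0) ->
  lattice_ideal trivial_exponents f.
Proof.
move=> [alpha hf] f0.
pose chi (a : 'X_{1..r}) (t : split_torus K r) := torus_char t (exponent_vector a).
pose same a b := [forall t in H, chi a t == chi b t].
(* [same] as an equality of values in a finite type, to index a partition. *)
pose cls a := [ffun t => if t \in H then chi a t else 0].
have clsE a b : (cls a == cls b) = same a b.
  apply/eqP/forall_inP => [/ffunP ab t Ht|ab].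
    by have := ab t; rewrite !ffunE Ht => ->.
  by apply/ffunP => t; rewrite !ffunE; case: ifP => // /ab/eqP.
have evalE t : f.@[torus_point t] = \sum_(a <- msupp f) f@_a * chi a t.
  rewrite {1}[f]mpolyE raddf_sum; apply: eq_bigr => a _.
  by rewrite /= mevalZ meval_torus_char.
have class_sum b : \sum_(a <- msupp f | same a b) f@_a = 0.
  apply: (@dedekind_character_coef K _ H _ chi (msupp f) b _ (fun a => f@_a)).
  - by move=> a; apply: torus_char1.
  - by move=> a s t _ _; apply: torus_charM.
  move=> t Ht; apply: etrans _ (f0 t Ht); rewrite evalE.
  rewrite [RHS](bigID (same^~ b)) /=; congr (_ + _).
  by rewrite mulr_suml; apply: eq_bigr => a /forall_inP/(_ t Ht)/eqP <-.
rewrite [f]mpolyE (partition_big cls xpredT) //=.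
apply: ideal_gen_sum => x _.
have [/hasP[b bf /eqP <-]|/hasPn none] := boolP (has (fun a => cls a == x) (msupp f));
  last first.
  rewrite big_seq_cond big1 => [|a /andP[/none/negPf ->] //].
  exact: ideal_gen0.
rewrite (eq_bigl (same^~ b)) => [|a]; last exact: clsE.
have -> : \sum_(a <- msupp f | same a b) f@_a *: 'X_[a] =
          \sum_(a <- msupp f | same a b) (f@_a)%:MP * ('X_[a] - 'X_[b]).
  apply/eqP; rewrite -subr_eq0 -sumrB.
  rewrite (eq_bigr (fun a => f@_a *: 'X_[b])) => [|a _].
    by rewrite -scaler_suml class_sum scale0r.
  by rewrite mul_mpolyC scalerBr opprB addrC subrK.
rewrite big_seq_cond; apply: ideal_gen_sum => a /andP[af /forall_inP ab].
apply: ideal_genM; rewrite mpolyXB; apply/ideal_genM/mem_ideal_gen.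
eexists; last by [].
apply/trivial_exponentsP; split=> [|t Ht].
  by rewrite raddfB -!mono_degreeE (hf _ af) (hf _ bf) subrr.
by rewrite torus_charB -/(chi a t) (eqP (ab t Ht)) divff ?torus_char_neq0.
Qed.

End LatticeOfSubgroup.

Theorem theorem2p9 (R : realType) (K : finFieldType) (n r : nat)
    (Sigma : set (set 'rV[R]_n)) (phi : 'M[int]_(r, n))
    (A : zmodType) (beta : {additive 'cV[int]_r -> A})
    (Sigma_fan : is_fan Sigma)
    (Sigma_complete : complete_fan Sigma)
    (Sigma_simplicial : simplicial_fan Sigma)
    (phi_rays : ray_generators Sigma phi)
    (beta_exact : class_group_exact phi beta)
    (torsion_coprime : exists2 N, torsion_order A N &
       forall p, p \in [pchar K] -> coprime N p)
    (pi_surjective : (torus_map K phi @* [set: split_torus K r])%g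
                     = [set: split_torus K n])
    (Y : {set {set affine_space K r}})
    (Y_torus : Y \subset torus_in_variety K phi Sigma) :
  is_lattice_ideal (vanishing_ideal beta Y) <-> is_torus_subgroup phi Y.
Proof.
have Y_incl : Y \subset torus_incl (phi := phi) @: [set: toric_torus K phi].
  by rewrite (torus_inclT K phi Sigma_complete).
split=> [[L [_ IL]]|[Q YQ]].
  (* [Y] is cut out in the torus by the characters in [L]. *)
  have mem_Y t : torus_incl (coset ('ker (torus_map K phi))%g t) \in Y <->
      forall m, m \in L -> torus_char t m = 1.
    split=> [tY m Lm|tL].
      apply/meval_lattice_binomial.
      have : vanishing_ideal beta Y ('X_[pos_part m] - 'X_[neg_part m]).
        by rewrite IL; apply: mem_ideal_gen; exists m.
      by apply: ideal_gen_root => g [_ /(vanishes_onE _ _ Y_incl)]; apply.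
    apply: contrapT => tY.
    have [f [hf ft fs]] := separating_polynomial t beta_exact.
    have : vanishing_ideal beta Y f.
      apply: mem_ideal_gen; split=> //; apply/(vanishes_onE _ _ Y_incl) => s sY.
      apply/eqP; apply: contrapT => /negP /fs/eq_coset_torus_map st.
      by apply: tY; rewrite -st.
    rewrite IL => fL; move/eqP: ft; apply.
    apply: ideal_gen_root fL => _ [m Lm ->].
    exact/meval_lattice_binomial/tL.
  pose Q := [set C : toric_torus K phi | torus_incl C \in Y].
  have gQ : group_set Q.
    apply/group_setP; split.
      rewrite inE -(morph1 (coset_morphism ('ker (torus_map K phi))%g)).
      by apply/mem_Y => m _; apply: torus_char1.
    move=> C D; have [s ->] := toric_torusP C; have [t ->] := toric_torusP D.
    rewrite !inE => sY tY.
    rewrite -morphM ?torus_norm_ker //; apply/mem_Y => m Lm.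
    by rewrite torus_charM (proj1 (mem_Y s) sY m Lm) (proj1 (mem_Y t) tY m Lm) mulr1.
  exists (Group gQ); apply/setP => y; apply/idP/imsetP => [yY|[C]].
    have /imsetP[C _ yC] := fintype.subsetP Y_incl y yY.
    by exists C => //; rewrite inE -yC.
  by rewrite inE => CY ->.
(* The group of all points of the big torus that lie over [Y]. *)
pose H := (coset ('ker (torus_map K phi))%g @*^-1 Q)%G.
have mem_H t : t \in H <-> torus_incl (coset ('ker (torus_map K phi))%g t) \in Y.
  rewrite YQ (mem_imset _ _ torus_incl_inj).
  by rewrite inE torus_norm_ker inE.
exists (trivial_exponents beta H); split.
  exact: zmod_closed_trivial_exponents.
apply/seteqP; split.
  apply: ideal_gen_min => f [hf /(vanishes_onE _ _ Y_incl) f0].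
  by apply: homogeneous_vanishing_lattice => // t /mem_H; apply: f0.
apply: ideal_gen_min => _ [m /trivial_exponentsP[bm hm] ->].
apply: mem_ideal_gen; split; first exact: homogeneous_lattice_binomial.
apply/(vanishes_onE _ _ Y_incl) => t /mem_H tH.
exact/meval_lattice_binomial/hm.
Qed.
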